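(* Let $K=\{0,1\}^{\mathfrak{c}^+}$ with the usual (Tychonoff) product topology, a compact space of weight $\mathfrak{c}^+$. Then the box product $\square K^\omega$ is not a $D$-space.
   Context: $\mathfrak{c}=2^{\aleph_0}$ and $\mathfrak{c}^+$ is its successor cardinal. A neighbornet on a space $(X,\tau)$ is a map $U:X\to\tau$ with $x\in U(x)$ for all $x\in X$. $X$ is a $D$-space if for every neighbornet $U$ on $X$ there is a closed discrete $D\subseteq X$ with $\bigcup_{x\in D}U(x)=X$. For a space $X$, the box product $\square X^\omega$ is the set $X^\omega$ with the topology generated by all sets $\prod_{n\in\omega} U_n$ with every $U_n$ open in $X$. *)

(* Defs.v *)
From HB Require Import structures.
From mathcomp Require Import all_boot all_classical.
From mathcomp Require Import topology.

Set Implicit Arguments.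
Unset Strict Implicit.
Unset Printing Implicit Defensive.

Local Open Scope classical_set_scope.
Local Open Scope card_scope.

Definition card_lt (T U : Type) (A : set T) (B : set U) : Prop :=
  (A #<= B) /\ ~ (B #<= A).

(* |A| is the least cardinal strictly above |B|. *)
Definition succ_card (T U : Type) (A : set T) (B : set U) : Prop :=
  card_lt B A /\ forall (V : Type) (C : set V), card_lt B C -> A #<= C.

(* The cardinal w(X) = min {|B| : B is a base of X} equals |A|. *)
Definition has_weight (X : topologicalType) (T : Type) (A : set T) : Prop :=
  (exists2 B : set (set X), basis B & B #= A) /\
  (forall B : set (set X), basis B -> A #<= B).

Definition neighbornet (X : topologicalType) (U : X -> set X) : Prop :=
  forall x, open_nbhs x (U x).

(* [D `<=` isolated D] says that the subspace D is discrete. *)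
Definition D_space (X : topologicalType) : Prop :=
  forall U : X -> set X, neighbornet U ->
    exists D : set X,
      [/\ closed D, D `<=` isolated D & \bigcup_(x in D) U x = setT].

(* A new name for the type of sequences: for uniform X, [nat -> X] already
   carries the topology of uniform convergence. *)
Definition box_power (X : Type) : Type := nat -> X.

Section box_topology.
Context {X : topologicalType}.

Definition box (U : nat -> set X) : set (box_power X) :=
  [set f | forall n, U n (f n)].

Let open_seq : set (nat -> set X) := [set U | forall n, open (U n)].

Let box_cover : \bigcup_(U in open_seq) box U = setT.
Proof.
by apply/seteqP; split=> // f _; exists (fun=> setT) => // n; exact: openT.
Qed.

Let box_join U V f : open_seq U -> open_seq V -> box U f -> box V f ->
  exists W, [/\ open_seq W, box W f & box W `<=` box U `&` box V].
Proof.
move=> oU oV Uf Vf; exists (fun n => U n `&` V n); split.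
- by move=> n; exact: openI.
- by move=> n; split.
- by move=> g UVg; split=> n; have [] := UVg n.
Qed.

HB.instance Definition _ := Choice.copy (box_power X) (nat -> X).
HB.instance Definition _ :=
  isBaseTopological.Build (box_power X) box_cover box_join.

End box_topology.

(* Main.v *)
Require Import Defs.
From HB Require Import structures.
From mathcomp Require Import all_boot all_classical.
From mathcomp Require wochoice.
From mathcomp Require Import topology.

(** Write c for the continuum, and well-order the index set I, of cardinality
    c^+, so that all proper initial segments have size at most c
    ([exists_short_order]).

    A point of the box power of the cube is a map from I to the sets of naturals,
    that is to c: the n-th factor supplies the n-th bit at every coordinate
    ([column]). Let F be the closed set of those maps that are injective with
    nonempty values on a proper initial segment of I and take the value [set0] from
    there on; the length of such a point is the first coordinate where it is empty.
    Requiring the column of f at its length to be empty is an open condition, and it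
    catches only the points of F that are no longer than f. With the complement of F
    around the points outside F this is a neighbornet. A set D that is a kernel of it
    must therefore contain points of F of arbitrarily large length, since every
    initial segment of I injects into c ([exists_longer]).

    Such a D is never closed discrete ([accumulation]). A box neighbourhood fixes at
    most countably many columns, and there are only c many countable conditions on
    the columns in a set of size c, because c^omega = c. So some initial segment M of
    size at most c reflects D: a countable condition on M that holds for some member
    of D holds for a member of length in M ([closure_le_continuum] builds M). A member
    t of D longer than M, cut off at M, is then an accumulation point of D.

    For the weight of the cube, a base of size at most c would make I of size at
    most c, since a nonempty basic open set restricts finitely many coordinates; so
    every base is larger than c, hence at least as large as I. The finite cylinders
    number at most c^+ * c, and c^+ * c = c^+ by a transfinite recursion
    ([setX_continuum_le]). *)

Set Implicit Arguments.
Unset Strict Implicit.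
Unset Printing Implicit Defensive.

Local Open Scope classical_set_scope.
Local Open Scope card_scope.

(** * Sets of cardinality at most the continuum *)

Lemma card_le_injP (T U : Type) (u0 : U) (A : set T) (B : set U) :
  A #<= B <-> exists f : T -> U, (forall x, A x -> B (f x)) /\
    {in A &, injective f}.
Proof.
pose U' : pointedType :=
  HB.pack U (gen_eqMixin U) (gen_choiceMixin U) (isPointed.Build U u0).
split.
  move=> /(@pcard_leP T U')[f]; exists f; split; last exact: inj.
  by move=> x; exact: (@funS _ _ _ _ f).
move=> [f [fAB finj]].
have /card_eqPle[_ h] := inj_card_eq finj.
by apply: card_le_trans h _; apply: subset_card_le => _ [x /fAB ? <-].
Qed.

Lemma card_le_continuumP (T : Type) (t0 : T) (A : set T) :
  A #<= [set: set nat] <-> exists s : set nat -> T, A `<=` range s.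
Proof.
pose T' : pointedType :=
  HB.pack T (gen_eqMixin T) (gen_choiceMixin T) (isPointed.Build T t0).
split; first by move=> /(@pcard_surjP T')[s sA]; exists s.
move=> [s sA]; apply: card_le_trans (subset_card_le sA) _.
exact: card_image_le.
Qed.

Lemma injective_card_le (T U : Type) (A : set T) (f : T -> U) :
  {in A &, injective f} -> A #<= [set: U].
Proof.
move=> fi; have /card_eqPle[_ h] := inj_card_eq fi.
by apply: card_le_trans h _; exact: card_leT.
Qed.

Lemma inhabited_of_not_le_continuum (T : Type) :
  ~ ([set: T] #<= [set: set nat]) -> exists t : T, True.
Proof.
move=> Tgtc; apply: contrapT => noT; apply: Tgtc.
by apply: (injective_card_le (f := fun=> set0)) => t; case: noT; exists t.
Qed.

(** A sequence of sets of naturals is the set of codes of the pairs in its graph,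
    a subset of a countable set. *)
Lemma seqs_le_continuum (C : countType) : [set: C -> set nat] #<= [set: set nat].
Proof.
apply: (injective_card_le
  (f := fun g => [set k | exists c m, k = pickle (c, m) /\ g c m])).
move=> g h _ _ /= /seteqP[gh hg]; apply/funext => c; apply/seteqP; split=> m Hm.
  have [|c' [m' [/(pcan_inj pickleK)[-> ->]]]//] := gh (pickle (c, m)).
  by exists c, m.
have [|c' [m' [/(pcan_inj pickleK)[-> ->]]]//] := hg (pickle (c, m)).
by exists c, m.
Qed.

(** A point of the union is named by two sets of naturals, one for the index and
    one for the point inside the member with that index. *)
Lemma bigcup_le_continuum (T J : Type) (A : set J) (F : J -> set T) :
  A #<= [set: set nat] -> (forall j, A j -> F j #<= [set: set nat]) ->
  \bigcup_(j in A) F j #<= [set: set nat].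
Proof.
move=> Ac Fc; have [->|/set0P[t0 [j0 _ _]]] := eqVneq (\bigcup_(j in A) F j) set0.
  exact: card_ge0.
have [s sA] := (card_le_continuumP j0 A).1 Ac.
have /choice[e eF] : forall j, exists e : set nat -> T, A j -> F j `<=` range e.
  move=> j; have [Aj|nAj] := pselect (A j); last by exists (fun=> t0).
  by have [e Fe] := (card_le_continuumP t0 (F j)).1 (Fc _ Aj); exists e.
apply: (card_le_trans _ (seqs_le_continuum nat)).
pose point_of (u : nat -> set nat) := e (s (u 0)) (u 1).
apply: (@card_le_trans _ _ _ (range point_of)); last exact: card_image_le.
apply: subset_card_le => t [j Aj Fjt].
have [x _ xj] := sA _ Aj; have [y _ yt] := eF _ Aj _ Fjt.
by exists (fun k => if k is 0 then x else y) => //; rewrite /point_of /= xj.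
Qed.

Lemma setU_le_continuum (T : Type) (A B : set T) :
  A #<= [set: set nat] -> B #<= [set: set nat] -> A `|` B #<= [set: set nat].
Proof.
move=> Ac Bc.
rewrite (_ : A `|` B = \bigcup_(b in [set: bool]) if b then A else B).
  apply: bigcup_le_continuum => [|[] _ //].
  apply: (injective_card_le (f := fun b : bool => [set n | b])).
  by move=> [] [] _ _ // /seteqP[h1 h2]; [have := h1 0 isT|have := h2 0 isT].
apply/seteqP; split=> t; first by move=> [?|?]; [exists true|exists false].
by move=> [[] _]; [left|right].
Qed.

(** A maximal partial bijection between [A] and [B], seen as a graph, exhausts one
    of the two sides: otherwise a pair of unmatched points extends it. *)
Lemma card_le_total (T U : Type) (A : set T) (B : set U) :
  A #<= B \/ B #<= A.
Proof.
pose P (G : set (T * U)) := [/\ G `<=` A `*` B,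
  forall p q, G p -> G q -> p.1 = q.1 -> p = q &
  forall p q, G p -> G q -> p.2 = q.2 -> p = q].
have [|G [[GAB G1 G2] maxG]] := @Zorn_bigcup _ P.
  move=> C CP Ctot; split.
  - by move=> p [G /CP[GAB _ _]]; exact: GAB.
  - move=> p q [G CG Gp] [H CH Hq].
    have [GH|HG] := Ctot _ _ CG CH.
      by have [_ h _] := CP _ CH; apply: h => //; exact: GH.
    by have [_ h _] := CP _ CG; apply: h => //; exact: HG.
  - move=> p q [G CG Gp] [H CH Hq].
    have [GH|HG] := Ctot _ _ CG CH.
      by have [_ _ h] := CP _ CH; apply: h => //; exact: GH.
    by have [_ _ h] := CP _ CG; apply: h => //; exact: HG.
have fst_le : fst @` G #= G.
  by apply: inj_card_eq => p q /set_mem Gp /set_mem Gq; exact: G1.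
have snd_le : snd @` G #= G.
  by apply: inj_card_eq => p q /set_mem Gp /set_mem Gq; exact: G2.
have [AG|nAG] := pselect (A `<=` fst @` G).
  left; apply: card_le_trans (subset_card_le AG) _.
  rewrite (card_le_eql fst_le) -(card_le_eql snd_le).
  by apply: subset_card_le => _ [p /GAB[_ Bp] <-].
right.
apply: card_le_trans (_ : B #<= snd @` G) _; last first.
  rewrite (card_le_eql snd_le) -(card_le_eql fst_le).
  by apply: subset_card_le => _ [p /GAB[Ap _] <-].
apply: subset_card_le; apply: contrapT => nBG.
have /existsNP[x /not_implyP[Ax nx]] := nAG.
have /existsNP[y /not_implyP[By ny]] := nBG.
have nG : ~ G (x, y) by move=> Gxy; apply: nx; exists (x, y).
apply: (maxG (G `|` [set (x, y)])).
  split=> [|GG]; first by move=> p; left.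
  by apply: nG; apply: GG; right.
split.
- by move=> p [/GAB//|->].
- move=> p q [Gp|->] [Gq|->] //=; first exact: G1.
    by move=> pq; case: nx; exists p.
  by move=> qp; case: nx; exists q.
- move=> p q [Gp|->] [Gq|->] //=; first exact: G2.
    by move=> pq; case: ny; exists p.
  by move=> qp; case: ny; exists q.
Qed.

(** * A well-order of type the successor of the continuum *)

Record short_order (I : Type) (lt : I -> I -> Prop) : Prop := ShortOrder {
  short_wf : well_founded lt;
  short_trans : forall i j k, lt i j -> lt j k -> lt i k;
  short_total : forall i j, [\/ lt i j, i = j | lt j i];
  short_seg : forall i, [set j | lt j i] #<= [set: set nat] }.

Lemma exists_well_order (I : Type) : exists lt : I -> I -> Prop,
  [/\ well_founded lt, forall i j k, lt i j -> lt j k -> lt i k &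
   forall i j, [\/ lt i j, i = j | lt j i] ].
Proof.
have [R Rwo] := @wochoice.well_ordering_principle {classic I}.
have wo (A : set I) : A !=set0 -> exists2 m, A m & forall x, A x -> R m x.
  move=> [x Ax].
  have [|m [[/asboolP Am lm] _]] := Rwo (fun x => `[< A x >]).
    by exists x; apply/asboolP.
  by exists m => // z Az; apply: lm; apply/asboolP.
have Rwo' : wochoice.wo_chain R predT by move=> A _; exact: Rwo.
have Rtot i j : R i j || R j i by apply: (wochoice.wo_chainW Rwo').
have Ranti i j : R i j -> R j i -> i = j.
  move=> ij ji; apply: (wochoice.wo_chain_antisymmetric Rwo') => //.
  by rewrite ij ji.
have tot i j : [\/ R i j /\ i <> j, i = j | R j i /\ j <> i].
  have [->|ij] := pselect (i = j); first exact: Or32.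
  by have /orP[?|?] := Rtot i j; [apply: Or31|apply: Or33]; split=> // /esym.
exists (fun i j => R i j /\ i <> j); split; last exact: tot.
- move=> i; apply: contrapT => nacc.
  have [m nm lm] := wo [set i | ~ Acc (fun i j => R i j /\ i <> j) i]
    (ex_intro _ i nacc).
  apply: nm; split=> j [jm njm]; apply: contrapT => /lm mj.
  by apply: njm; exact: Ranti.
- move=> i j k [ij nij] [jk njk].
  have [|m [->|->|->] lm] := wo [set x | [\/ x = i, x = j | x = k]].
  + by exists i; apply: Or31.
  + split; first by apply: lm; apply: Or33.
    by move=> ik; apply: njk; apply: Ranti => //; rewrite -ik.
  + by case: nij; apply: Ranti => //; apply: lm; apply: Or31.
  + by case: njk; apply: Ranti => //; apply: lm; apply: Or32.
Qed.

Lemma wf_minimal (I : Type) (lt : I -> I -> Prop) (A : set I) :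
  well_founded lt -> A !=set0 -> exists2 m, A m & forall x, lt x m -> ~ A x.
Proof.
move=> wf [x Ax]; apply: contrapT => nm.
elim/(well_founded_ind wf): x Ax => x IH Ax.
by apply: nm; exists x => // y yx /(IH _ yx).
Qed.

(** Cut an arbitrary well-order at the first segment longer than the continuum, if
    there is one. By minimality of its cardinal, [I] embeds in that segment,
    all of whose own initial segments are at most the continuum; the order is then
    pulled back along the embedding. *)
Lemma exists_short_order (I : Type) :
  succ_card [set: I] [set: set nat] -> exists lt, @short_order I lt.
Proof.
move=> [[_ Igtc] Imin].
have [lt [wf tr tot]] := exists_well_order I.
have [short|] := pselect (forall i, [set j | lt j i] #<= [set: set nat]).
  by exists lt; split.
move=> /existsNP long.
have [m mlong mmin] := wf_minimal wf long.
have Im : [set: I] #<= [set j | lt j m].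
  apply: Imin; split=> //.
  by have [] := card_le_total [set: set nat] [set j | lt j m].
have /(card_le_injP m)[f [fm fIinj]] := Im.
have finj : injective f by move=> i j; apply: fIinj; rewrite in_setT.
have {}fm i : lt (f i) m by exact: fm.
exists (fun i j => lt (f i) (f j)); split.
- suff acc x i : f i = x -> Acc (fun i j => lt (f i) (f j)) i.
    by move=> i; exact: (acc _ i erefl).
  elim/(well_founded_ind wf): x i => x IH i fi.
  constructor=> j; rewrite fi => ltj; exact: IH ltj _ erefl.
- by move=> i j k; exact: tr.
- move=> i j; have [ij|/finj ij|ij] := tot (f i) (f j).
  + exact: Or31.
  + exact: Or32.
  + exact: Or33.
- move=> i; apply: (@card_le_trans _ _ _ [set j | lt j (f i)]); last first.
    exact: contrapT (mmin _ (fm i)).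
  have /card_eqPle[_ h] :=
    inj_card_eq (f := f) (A := [set j | lt (f j) (f i)]) (in2W finj).
  apply: card_le_trans h _; apply: subset_card_le.
  by move=> _ [j ? <-].
Qed.

Section short_order.
Context {I : Type} (lt : I -> I -> Prop) (Ilt : short_order lt).
Context (Igtc : ~ ([set: I] #<= [set: set nat])).

Definition seg_le i : set I := [set j | lt j i \/ j = i].

Lemma seg_le_continuum i : seg_le i #<= [set: set nat].
Proof.
apply: setU_le_continuum; first exact: short_seg.
by apply: (injective_card_le (f := fun=> set0)) => x y /set_mem-> /set_mem->.
Qed.

(** By recursion along the order, give each [i] a copy of the continuum in [I] that
    avoids the copies given to its predecessors. There is room: those copies
    together are at most the continuum, so their complement is not, and by
    comparability the complement contains a copy of the continuum. *)
Lemma setX_continuum_le : [set: I * set nat] #<= [set: I].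
Proof.
have [i0 _] := inhabited_of_not_le_continuum Igtc.
have fresh (A : set I) : exists e : set nat -> I, A #<= [set: set nat] ->
    (forall x, ~ A (e x)) /\ injective e.
  have [Ac|nAc] := pselect (A #<= [set: set nat]); last by exists (fun=> i0).
  have /(card_le_injP i0)[e [eA einj]] : [set: set nat] #<= ~` A.
    have [//|cA] := card_le_total [set: set nat] (~` A).
    by case: Igtc; rewrite -(setUv A); exact: setU_le_continuum.
  exists e => _; split=> [x|x y]; first exact: eA.
  by apply: einj; rewrite in_setT.
have /choice[e eP] := fresh.
pose phi := Fix (short_wf Ilt) (fun=> set nat -> I) (fun i rec =>
  e (\bigcup_(j in [set: {j | lt j i}]) range (rec (sval j) (svalP j)))).
have phiE i : phi i = e (\bigcup_(j in [set j | lt j i]) range (phi j)).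
  rewrite /phi Fix_eq; last first.
    move=> {}i f g fg; congr e; apply: eq_bigcupr => j _.
    by rewrite fg.
  congr e; apply/seteqP; split=> x.
    by move=> [[j ji] _ [s _ <-]]; exists j => //; exists s.
  by move=> [j ji [s _ <-]]; exists (exist _ j ji) => //; exists s.
have phiP i : (forall j x y, lt j i -> phi i x <> phi j y) /\ injective (phi i).
  have [|e1 e2] := eP (\bigcup_(j in [set j | lt j i]) range (phi j)).
    apply: bigcup_le_continuum => [|j _]; first exact: short_seg.
    exact: card_image_le.
  rewrite -phiE in e1 e2; split=> // j x y ji E.
  by apply: (e1 x); exists j => //; exists y.
apply: (injective_card_le (f := fun p => phi p.1 p.2)).
move=> [i x] [j y] _ _ /= E.
have [ij|ij|ij] := short_total Ilt i j.
- by have [h _] := phiP j; have := h i y x ij; rewrite E.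
- by rewrite -ij in E *; have [_ /(_ _ _ E)->] := phiP i.
- by have [h _] := phiP i; have := h j x y ij; rewrite E.
Qed.

End short_order.

(** * Closing a point under operations of countable arity *)

(** An injection of the sets of naturals into the nonempty ones. *)
Definition shift (A : set nat) : set nat := 0 |` (succn @` A).

Lemma shift_neq0 A : shift A <> set0.
Proof. by move=> /seteqP[/(_ 0 (or_introl erefl))]. Qed.

Lemma shift_inj : injective shift.
Proof.
suff sub A B : shift A = shift B -> A `<=` B.
  by move=> A B AB; apply/seteqP; split; exact: sub.
move=> /seteqP[AB _] n An.
by have [|//|[m Bm [<-]]] := AB n.+1; first by right; exists n.
Qed.

(** Terms for the elements generated from one point by operations of arity
    [nat] indexed by [L]. Generating along an inductive type replaces an iteration
    of length omega_1. *)
Inductive tree (L : Type) : Type :=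
  Leaf | Node of L & (nat -> tree L).
Arguments Leaf {L}.

(** The tree as the map from its addresses to its labels; [set0] is read at a leaf
    and below it, and [shift] keeps proper labels away from [set0]. *)
Fixpoint tree_code (L : Type) (c : L -> set nat) (t : tree L)
    (s : seq nat) : set nat :=
  match t, s with
  | Leaf, _ => set0
  | Node l _, [::] => shift (c l)
  | Node _ ch, n :: s' => tree_code c (ch n) s'
  end.

Lemma tree_code_inj (L : Type) (c : L -> set nat) :
  injective c -> injective (tree_code c).
Proof.
move=> cinj; elim=> [|l ch IH] [|l' ch'] //= E.
- by have /= /esym/shift_neq0 := congr1 (@^~ [::]) E.
- by have /= /shift_neq0 := congr1 (@^~ [::]) E.
- have /= /shift_inj/cinj -> := congr1 (@^~ [::]) E.
  congr Node; apply/funext => n; apply: IH; apply/funext => s.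
  exact: (congr1 (fun h => h (n :: s)) E).
Qed.

(** The closure is the set of values of the trees, and [tree_code] embeds the trees
    into the sequences of sets of naturals. *)
Lemma closure_le_continuum (T L : Type) (t0 : T) (op : (nat -> T) -> L -> T) :
  [set: L] #<= [set: set nat] ->
  exists M : set T, [/\ M t0, M #<= [set: set nat] &
    forall a l, (forall n, M (a n)) -> M (op a l)].
Proof.
move=> Lc; pose fix val (t : tree L) : T :=
  if t is Node l ch then op (fun n => val (ch n)) l else t0.
have /(card_le_injP set0)[c [_ cinj]] := Lc.
exists (range val); split; first by exists Leaf.
- apply: card_le_trans (card_image_le _ _) _.
  apply: card_le_trans (seqs_le_continuum (seq nat)).
  apply: (injective_card_le (f := tree_code c)).
  apply: in2W; apply: tree_code_inj => x y.
  by apply: cinj; rewrite in_setT.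
- move=> a l /(_ _)/cid2-/all_sig2[ch _ chE]; exists (Node l ch) => //=.
  by congr op; apply/funext.
Qed.

Lemma seqs2_le_continuum :
  [set: (nat -> set nat) * (nat -> set nat)] #<= [set: set nat].
Proof.
apply: card_le_trans (seqs_le_continuum (nat + nat)%type).
apply: (injective_card_le
  (f := fun p k => match k with inl n => p.1 n | inr n => p.2 n end)).
move=> [u v] [u' v'] _ _ /= E; congr pair; apply/funext => n.
  exact: (congr1 (fun h => h (inl n)) E).
exact: (congr1 (fun h => h (inr n)) E).
Qed.

(** * The Cantor cube and its weight *)

Section cube.
Context {I : Type}.
Local Notation K := {ptws I -> bool}.
Implicit Types (f g : K).

Lemma open_coordinate (i : I) (b : bool) : open [set f : K | f i = b].
Proof.
have pc := @proj_continuous {classic I} (fun=> bool) i.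
have /continuousP/(_ [set b]) : continuous (fun f : K => f i) by exact: pc.
by apply; exact: discrete_open.
Qed.

(** The supersets of finite cylinders around [f] form a filter that converges to [f]
    coordinatewise, hence contains all neighbourhoods of [f]. *)
Lemma nbhs_cylinder (i0 : I) f (A : set K) : nbhs f A ->
  exists (n : nat) (a : nat -> I),
    [set g : K | forall k, k < n -> g (a k) = f (a k)] `<=` A.
Proof.
pose F : set_system K := [set A | exists (n : nat) (a : nat -> I),
    [set g : K | forall k, k < n -> g (a k) = f (a k)] `<=` A].
have FF : Filter F.
  split.
  - by exists 0, (fun=> i0).
  - move=> B C [n [a aB]] [m [b bC]].
    exists (n + m), (fun k => if k < n then a k else b (k - n)) => g gf; split.
      by apply: aB => k kn; have := gf k (ltn_addr _ kn); rewrite kn.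
    apply: bC => k km; have := gf (n + k); rewrite ltn_add2l => /(_ km).
    by rewrite ltnNge leq_addr /= addKn.
  - by move=> B C BC [n [a aB]]; exists n, a; exact: subset_trans BC.
suff : F --> f by apply.
apply/cvg_sup => i B [_ [[C oC <-] Cf CB]].
exists 1, (fun=> i) => g /(_ 0 isT) gf; apply: CB => /=.
by rewrite gf.
Qed.

Lemma compact_cube : compact [set: K].
Proof.
have := @tychonoff {classic I} (fun=> bool) (fun=> setT) (fun=> bool_compact).
by congr compact; apply/seteqP; split.
Qed.

Lemma open_cylinder (a : nat -> I) (b : nat -> bool) (n : nat) :
  open [set f : K | forall k, k < n -> f (a k) = b k].
Proof.
elim: n => [|n IHn].
  rewrite (_ : [set _ | _] = setT); first exact: openT.
  by apply/seteqP; split.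
rewrite (_ : [set _ | _] = [set f : K | forall k, k < n -> f (a k) = b k] `&`
    [set f : K | f (a n) = b n]); first exact: openI IHn (open_coordinate _ _).
apply/seteqP; split=> f /= fab.
  by split=> [k kn|]; apply: fab => //; exact: ltnW.
move=> k; rewrite ltnS leq_eqVlt => /orP[/eqP->|]; [exact: fab.2|exact: fab.1].
Qed.

Lemma nat_le_continuum (A : set nat) : A #<= [set: set nat].
Proof.
apply: (injective_card_le (f := fun n => [set n])) => m n _ _.
by move=> /seteqP[/(_ m erefl)].
Qed.

(** A member of the base containing the zero point contains a finite cylinder
    around it, so it lies inside [f i = false] for finitely many [i] only; but every
    [i] is served by some member. So a base of size at most the continuum would
    bound [I] by the continuum. *)
Lemma base_gt_continuum (B : set (set K)) :
  ~ ([set: I] #<= [set: set nat]) -> basis B -> ~ (B #<= [set: set nat]).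
Proof.
move=> Igtc [Bo Bb] Bc; apply: Igtc.
pose f0 : K := fun=> false.
pose F (b : set K) := [set i | b f0 /\ b `<=` [set f : K | f i = false]].
suff -> : [set: I] = \bigcup_(b in B) F b.
  apply: bigcup_le_continuum => // b Bb'.
  have [->|/set0P[i [bf0 bi]]] := eqVneq (F b) set0; first exact: card_ge0.
  have /(nbhs_cylinder i)[n [a ab]] : nbhs f0 b.
    by apply: open_nbhs_nbhs; split=> //; exact: Bo.
  apply: (@card_le_trans _ _ _ (range a)).
    apply: subset_card_le => j [_ bj]; apply: contrapT => aj.
    have /bj/= : b (fun x => `[< x = j >]).
      by apply: ab => k _; apply/asboolP => akj; apply: aj; exists k.
    by rewrite asboolT.
  by apply: card_le_trans (card_image_le _ _) (nat_le_continuum _).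
apply/seteqP; split=> // i _.
have [|b [Bb' bf0] bi] := Bb f0 [set f : K | f i = false]; last by exists b.
by apply: open_nbhs_nbhs; split=> //; exact: open_coordinate.
Qed.

(** A finite set of coordinates lies below some [i], so a finite cylinder is given
    by [i] and by finitely many names of elements of the segment of [i], that is by
    an element of [I] and a set of naturals. *)
Lemma exists_base (lt : I -> I -> Prop) : short_order lt ->
  ~ ([set: I] #<= [set: set nat]) ->
  exists2 B : set (set K), basis B & B #<= [set: I].
Proof.
move=> Ilt Igtc.
have /choice[s sP] : forall i, exists s : set nat -> I, seg_le lt i `<=` range s.
  by move=> i; apply/(card_le_continuumP i); exact: seg_le_continuum.
(* The number of conditions, the names of the coordinates, the values. *)
pose L := (nat * ((nat -> set nat) * set nat))%type.
have Lc : [set: L] #<= [set: set nat].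
  apply: card_le_trans (seqs_le_continuum nat).
  apply: (injective_card_le (f := fun p : L => fun k =>
    match k with 0 => [set p.1] | 1 => p.2.2 | k'.+2 => p.2.1 k' end)).
  move=> [n [u v]] [n' [u' v']] _ _ /= E.
  have /seteqP[/(_ n erefl)/= <- _] := congr1 (fun h => h 0) E.
  have /= <- := congr1 (fun h => h 1) E.
  congr (_, (_, _)); apply/funext => k; exact: (congr1 (fun h => h k.+2) E).
pose V (p : I * L) : set K := [set f : K |
  forall k, k < p.2.1 -> f (s p.1 (p.2.2.1 k)) = `[< p.2.2.2 k >]].
exists (range V); first split.
- by move=> _ [[i [n [u v]]] _ <-]; exact: open_cylinder.
- move=> f A fA.
  have [i0 _] := inhabited_of_not_le_continuum Igtc.
  have [n [a aA]] := nbhs_cylinder i0 fA.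
  have [i ia] : exists i, forall k, k < n -> seg_le lt i (a k).
    elim: n {aA} => [|n [i ia]]; first by exists i0.
    have [ani|ani|ani] := short_total Ilt (a n) i; [exists i|exists i|exists (a n)];
      move=> k; rewrite ltnS leq_eqVlt => /orP[/eqP->|/ia].
    + by left.
    + done.
    + by right.
    + done.
    + by right.
    + by move=> [aki|->]; left => //; exact: (short_trans Ilt) aki ani.
  have /choice[u ua] : forall k, exists u, k < n -> s i u = a k.
    move=> k; have [/ia/sP[u _ ua]|_] := boolP (k < n); first by exists u.
    by exists set0.
  exists (V (i, (n, (u, [set k | f (a k)])))); first split.
  + by exists (i, (n, (u, [set k | f (a k)]))).
  + by move=> k /= kn; rewrite ua // asboolb.
  + by move=> g gV; apply: aA => k kn; have := gV k kn; rewrite /= ua // asboolb.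
- apply: card_le_trans (card_image_le _ _) _.
  apply: card_le_trans (setX_continuum_le Ilt Igtc).
  have /(card_le_injP set0)[c [_ cinj]] := Lc.
  apply: card_le_trans (_ : [set: I * L] #<= [set: I * set nat]) _ => //.
  apply: (injective_card_le (f := fun p : I * L => (p.1, c p.2))).
  by move=> [i l] [j m] _ _ /= [-> /cinj->//]; rewrite in_setT.
Qed.

Lemma weight_cube : succ_card [set: I] [set: set nat] -> has_weight K [set: I].
Proof.
move=> hI; have [[_ Igtc] Imin] := hI; have [lt Ilt] := exists_short_order hI.
have ge (B : set (set K)) : basis B -> [set: I] #<= B.
  move=> Bb; apply: Imin; have nBc := base_gt_continuum Igtc Bb; split=> //.
  by have [] := card_le_total B [set: set nat].
split=> //; have [B Bb BI] := exists_base Ilt Igtc.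
by exists B => //; apply/card_eqPle; split=> //; exact: ge.
Qed.

End cube.

(** * The box power *)

Section box_power.
Context {I : Type} (lt : I -> I -> Prop) (Ilt : short_order lt).
Context (Igtc : ~ ([set: I] #<= [set: set nat])).
Local Notation K := {ptws I -> bool}.
Local Notation X := (box_power K).
Implicit Types (f g z : X).

(** A point of the box power is read as a map from [I] to the sets of naturals. *)
Definition column (f : X) (i : I) : set nat := [set n | f n i].

Lemma open_column (i : I) (A : set nat) : open [set f | column f i = A].
Proof.
pose U n := [set h : K | h i = `[< A n >]].
exists [set U]; first by move=> _ /= -> n /=; exact: (open_coordinate i `[< A n >]).
rewrite bigcup_set1; change (box U = [set f | column f i = A]).
apply/seteqP; split=> f /=.
  move=> fU; apply/seteqP; split=> n; rewrite /column /= (fU n).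
    by move/asboolP.
  by move=> An; apply/asboolP.
move=> fA n; rewrite /U /= -fA /column /=; exact/esym/asboolb.
Qed.

(** A box neighbourhood restricts finitely many coordinates in each of the factors,
    hence countably many columns. *)
Lemma nbhs_columns (i0 : I) z (A : set X) : nbhs z A -> exists a : nat -> I,
  [set f | forall k, column f (a k) = column z (a k)] `<=` A.
Proof.
rewrite nbhsE => -[B [[D DU <-] [U DUU zU]] UA].
have oU n : open (U n) by exact: DU.
have {}zU : box U z by exact: zU.
have /choice[m mP] : forall n, exists m : nat * (nat -> I),
    [set h : K | forall k, k < m.1 -> h (m.2 k) = z n (m.2 k)] `<=` U n.
  move=> n; have [|m [a aU]] := nbhs_cylinder i0 (f := z n) (A := U n).
    by apply: open_nbhs_nbhs; split; [exact: oU|exact: (zU n)].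
  by exists (m, a).
pose a (k : nat) : I := if unpickle k is Some (n, j) then (m n).2 j else i0.
exists a => f fz; apply: UA; exists U => //.
suff : box U f by []; move=> n; apply: mP => k _.
have := fz (pickle (n, k)); rewrite /a pickleK => /seteqP[/(_ n) h1 /(_ n) h2].
by apply/idP/idP; [exact: h1|exact: h2].
Qed.

(** Up to padding by [set0], these points are the injections of proper initial
    segments of [I] into the nonempty sets of naturals: the tree of an Aronszajn-type
    argument, whose branches are shorter than [I]. *)
Definition injective_columns : set X := [set f |
  (forall i j, lt i j -> column f i = set0 -> column f j = set0) /\
  (forall i j, column f i = column f j -> i = j \/ column f i = set0)].
Local Notation F := injective_columns.

(** Each condition mentions two columns, and fixing the values of two columns is an
    open condition. *)
Lemma closed_injective_columns : closed F.
Proof.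
move=> f clFf.
have approx i j : exists g, [/\ F g, column g i = column f i &
    column g j = column f j].
  have [|g [Fg [gi gj]]] := clFf ([set g | column g i = column f i] `&`
    [set g | column g j = column f j]); last by exists g.
  by apply: filterI; apply: open_nbhs_nbhs; split=> //; exact: open_column.
split=> i j.
  have [g [[g0 _] <- <-]] := approx i j; exact: g0.
have [g [[_ ginj] <- <-]] := approx i j; exact: ginj.
Qed.

(** [d f] is the length of the injection; it exists because [I] does not inject into
    the sets of naturals. *)
Lemma exists_length : exists d : X -> I, forall f, F f ->
  column f (d f) = set0 /\ forall j, lt j (d f) -> column f j <> set0.
Proof.
have [i0 _] := inhabited_of_not_le_continuum Igtc.
suff /choice[d dP] : forall f, exists i, F f -> column f i = set0 /\
    forall j, lt j i -> column f j <> set0 by exists d.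
move=> f.
have [Ff|nFf] := pselect (F f); last by exists i0.
have [|i fi imin] := wf_minimal (A := [set i | column f i = set0]) (short_wf Ilt).
  apply: contrapT => n0; apply: Igtc.
  apply: (injective_card_le (f := column f)) => i j _ _ /Ff.2[//|fi].
  by case: n0; exists i.
by exists i.
Qed.

Lemma exists_longer i : exists2 f, F f & forall j, lt j i -> column f j <> set0.
Proof.
have /(card_le_injP set0)[e [_ einj]] := short_seg Ilt i.
pose f : X := fun n j => `[< lt j i /\ shift (e j) n >].
have fE j : lt j i -> column f j = shift (e j).
  move=> ji; apply/seteqP; split=> n; first by move=> /asboolP[].
  by move=> ?; apply/asboolP.
have f0 j : ~ lt j i -> column f j = set0.
  by move=> ji; apply/seteqP; split=> n // /asboolP[].
exists f; last by move=> j /fE->; exact: shift_neq0.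
split=> j k.
  move=> jk fj; apply: f0 => ki; have ji := short_trans Ilt jk ki.
  by move: fj; rewrite fE //; exact: shift_neq0.
have [ji|/f0 ->] := pselect (lt j i); last by right.
have [ki|/f0 ->] := pselect (lt k i); last by right.
by rewrite !fE // => /shift_inj/einj; rewrite !inE => jk; left; apply: jk.
Qed.

(** Let [M] be an initial segment of [I], of size at most the continuum, such that
    every countable condition on columns in [M] satisfied by a member of [D] is
    satisfied by a member of [D] of length in [M]. Some [t] in [D] is longer than [M],
    and the restriction [z] of [t] to [M] is the required point. Indeed a
    neighbourhood of [z] fixes countably many columns. Those in [M] are columns of
    [t], so some [f] in [D] of length in [M] agrees with [t] there; the others are
    empty for [z], and for [f] because they lie beyond its length. And [f] differs
    from [z] in the column at the length of [f]. *)
Lemma accumulation (D : set X) : D `<=` F ->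
  (forall i, exists2 f, D f & forall j, lt j i -> column f j <> set0) ->
  exists z, forall A, nbhs z A -> exists f, [/\ D f, A f & f <> z].
Proof.
move=> DF Dlong.
(* [s i] names the elements up to [i] by sets of naturals. *)
have /choice[s sP] : forall i, exists s : set nat -> I, seg_le lt i `<=` range s.
  by move=> i; apply/(card_le_continuumP i); exact: seg_le_continuum.
have [i0 _] := inhabited_of_not_le_continuum Igtc.
have [d dP] := exists_length.
(* The columns constrained are named relative to [a], so that closing [N] under
   [op] takes care of all columns of [M], the downward closure of [N]. *)
pose matching (a : nat -> I) (l : (nat -> set nat) * (nat -> set nat)) :=
  [set f | D f /\ forall n, column f (s (a n) (l.1 n)) = l.2 n].
have /choice[op opP] : forall a,
    exists op : (nat -> set nat) * (nat -> set nat) -> I, forall l,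
      matching a l !=set0 -> exists2 f, matching a l f & d f = op l.
  move=> a; suff /choice[op opP] : forall l, exists i, matching a l !=set0 ->
      exists2 f, matching a l f & d f = i by exists op.
  move=> l.
  have [[f fP]|none] := pselect (matching a l !=set0).
    by exists (d f) => _; exists f.
  by exists i0.
have [N [Ni0 Nc Nop]] := closure_le_continuum i0 op seqs2_le_continuum.
pose M := \bigcup_(m in N) seg_le lt m.
have Mdown i j : lt j i -> M i -> M j.
  move=> ji [m Nm [im|mi]]; exists m => //; left; last by rewrite -mi.
  exact: (short_trans Ilt) ji im.
have [i Mi] : exists i, ~ M i.
  apply: contrapT => allM; apply: Igtc.
  apply: card_le_trans (_ : M #<= _); last first.
    by apply: bigcup_le_continuum => // j _; exact: seg_le_continuum.
  by apply: subset_card_le => i _; apply: contrapT => nMi; apply: allM; exists i.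
have [t Dt tlong] := Dlong i.
have tM j : M j -> column t j <> set0.
  move=> Mj; apply: tlong; have [//|ij|ij] := short_total Ilt j i.
    by case: Mi; rewrite -ij.
  by case: Mi; exact: Mdown Mj.
pose z : X := fun n j => t n j && `[< M j >].
have zM j : M j -> column z j = column t j.
  move=> Mj; rewrite /column /z asboolT //.
  by apply/seteqP; split=> n /=; rewrite andbT.
have znM j : ~ M j -> column z j = set0.
  move=> Mj; rewrite /column /z asboolF //.
  by apply/seteqP; split=> n //=; rewrite andbF.
exists z => A /(nbhs_columns i0)[a aA].
(* Columns outside [M] are renamed as arbitrary columns in [M]: the extra
   condition on [f] is harmless, as [t] satisfies it. *)
have /choice[c cP] : forall k, exists c : I * set nat,
    N c.1 /\ (M (a k) -> s c.1 c.2 = a k).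
  move=> k; have [[m Nm /sP[u _ ua]]|nM] := pselect (M (a k)).
    by exists (m, u).
  by exists (i0, set0).
pose l := ((fun k => (c k).2), fun k => column t (s (c k).1 (c k).2)).
have [|f [Df fl] fd] := opP (fun k => (c k).1) l; first by exists t.
have Ndf : N (d f) by rewrite fd; apply: Nop => k; case: (cP k).
have Mdf : M (d f) by exists (d f) => //; right.
have [f0 _] := dP _ (DF _ Df).
exists f; split=> //.
- apply: aA => k; have [Mak|nMak] := pselect (M (a k)).
    by rewrite zM // -((cP k).2 Mak); exact: fl.
  rewrite znM //; have [ak|ak|ak] := short_total Ilt (d f) (a k).
  + by have [h _] := DF _ Df; exact: h ak f0.
  + by rewrite -ak.
  + by case: nMak; exact: Mdown Mdf.
- by move=> fz; apply: (tM _ Mdf); rewrite -zM // -fz.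
Qed.

(** The neighbourhood [U f] of a point of [F] catches only the points of [F] that are
    no longer than [f], and that of any other point misses [F]. So the members of [F]
    in a kernel have unbounded length, and they accumulate somewhere. *)
Lemma not_D_space_box_power : ~ D_space X.
Proof.
move=> DX.
have [d dP] := exists_length.
pose U f := if `[< F f >] then [set g | column g (d f) = set0] else ~` F.
have [|D [Dcl Ddis Dcov]] := DX U.
  move=> f; rewrite /U; case: asboolP => Ff.
    by split; [exact: open_column|case: (dP f Ff)].
  by split=> //; apply: closed_openC; exact: closed_injective_columns.
have [||z zP] := @accumulation (D `&` F).
- by move=> f [].
- move=> i; have [f Ff flong] := exists_longer i.
  have [t Dt Utf] : (\bigcup_(x in D) U x) f by rewrite Dcov.
  move: Utf; rewrite /U; case: asboolP => // Ft fdt.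
  exists t => // j ji; apply: (dP t Ft).2.
  have [//|dj|dj] := short_total Ilt j (d t).
    by case: (flong j ji); rewrite dj.
  by case: (flong _ (short_trans Ilt dj ji)).
have Dz : D z by apply: Dcl => A /zP[f [[Df _] Af _]]; exists f.
have [_ [V /zP[f [[Df _] Vf fz]] VD]] := Ddis _ Dz.
by apply: fz; have : (V `&` D) f by []; rewrite VD.
Qed.

End box_power.

Theorem mainTheorem3 (I : Type) (hI : succ_card [set: I] [set: set nat]) :
  let K := {ptws I -> bool} in
  [/\ compact [set: K],
      has_weight K [set: I]
    & ~ D_space (box_power K)].
Proof.
move=> K; have [[_ Igtc] _] := hI; have [lt Ilt] := exists_short_order hI.
split; [exact: compact_cube|exact: weight_cube|].
exact: not_D_space_box_power Ilt Igtc.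
Qed.
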